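(* Let $\Lambda$ be a finite $k$-graph with no sources or sinks, and let $r=(r_1,\dots,r_k)\in(0,\infty)^k$ satisfy $\max\{r_i^{-1}\ln\rho(A_i):1\le i\le k\}=1$. Suppose that $C\in\mathcal{C}$ is a $j$-critical component of $\Lambda$, and set $$\Sigma_jC:=\{w\in\Lambda^0: C\Lambda^{\mathbb{N}e_j}w\neq\emptyset\}.$$ Then for every KMS$_1$ state $\psi$ of $(\mathcal{T}C^*(\Lambda),\alpha^r)$ we have $\psi(q_w)=0$ for all $w\in H_j:=(\Sigma_jC)\setminus C$.
   Context: $\mathbb{N}=\{0,1,2,\dots\}$. A $k$-graph is a countable category $\Lambda$ with a functor $d:\Lambda\to\mathbb{N}^k$ such that whenever $d(\lambda)=m+n$ there are unique $\mu,\nu\in\Lambda$ with $d(\mu)=m$, $d(\nu)=n$, $\lambda=\mu\nu$. $\Lambda^n:=d^{-1}(n)$; $\Lambda^0$ (the vertices) is identified with the objects. The maps $s,r:\Lambda\to\Lambda^0$ are domain and codomain (the letter $r$ also denotes the vector $r\in(0,\infty)^k$). For $V\subset\Lambda^0$, $E\subset\Lambda$: $VE=\{\lambda\in E:r(\lambda)\in V\}$, $EV=\{\lambda\in E:s(\lambda)\in V\}$, $vE=\{v\}E$, $Ev=E\{v\}$. $e_1,\dots,e_k$ are the generators of $\mathbb{N}^k$, and $\Lambda^{\mathbb{N}e_j}=\bigcup_{n\in\mathbb{N}}\Lambda^{ne_j}$. $\Lambda$ is finite if every $\Lambda^n$ is finite; it has no sources (sinks) if $v\Lambda^n\ne\emptyset$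 ($\Lambda^nv\neq\emptyset$) for all $v\in\Lambda^0$, $n\in\mathbb{N}^k$. The vertex matrix $A_i$ is the $\Lambda^0\times\Lambda^0$ matrix $A_i(v,w)=|v\Lambda^{e_i}w|$; for $C\subset\Lambda^0$, $A_{C,i}$ is its $C\times C$ block; $\rho$ is the spectral radius. A square matrix $A$ is irreducible if for all $i,j$ there is $m\in\mathbb{N}$ with $A^m(i,j)\ne0$. Strongly connected components are the classes of the relation $v\sim w\iff v\Lambda w\neq\emptyset$ and $w\Lambda v\ne\emptyset$; a class $\{v\}$ with $v\Lambda v=\{v\}$ is trivial; $\mathcal{C}$ is the set of nontrivial strongly connected components. A component $C\in\mathcal{C}$ is $j$-critical (with respect to $r$) if $r_j=\ln\rho(A_j)=\ln\rho(A_{C,j})$ and $A_{C,j}$ is irreducible. A Toeplitz–Cuntz–Krieger $\Lambda$-family is a collection of partial isometries $\{T_\lambda:\lambda\in\Lambda\}$ in a $C^*$-algebra such that (T1) $\{Q_v:=T_v:v\in\Lambda^0\}$ are mutually orthogonal projections; (T2) $T_\lambda T_\mu=T_{\lambda\mu}$ if $s(\lambda)=r(\mu)$; (T3) $T_\lambda^*T_\mu=\sum_{(\alpha,\beta)\in\Lambda^{\min}(\lambda,\mu)}T_\alpha T_\beta^*$, where $\Lambda^{\min}(\lambda,\mu)=\{(\alpha,\beta):\lambda\alpha=\mu\beta\in\Lambda^{d(\lambda)\vee d(\mu)}\}$. $\mathcal{T}C^*(\Lambda)$ is generated by a universal such family $\{t_\lambda\}$, with $q_v:=t_v$. The dynamics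 $\alpha^r:\mathbb{R}\to\operatorname{Aut}\mathcal{T}C^*(\Lambda)$ is determined by $\alpha^r_t(t_\lambda)=e^{it\,r\cdot d(\lambda)}t_\lambda$. A state $\phi$ is a KMS$_\beta$ state ($\beta\in(0,\infty)$) for $\alpha$ if $\phi(ab)=\phi(b\alpha_{i\beta}(a))$ for all analytic $a,b$. *)

(* Defs.v *)
From HB Require Import structures.
From mathcomp Require Import all_boot all_order all_algebra finmap.
From mathcomp Require Import all_classical all_reals all_analysis complex.
Set Implicit Arguments.
Unset Strict Implicit.
Unset Printing Implicit Defensive.
Import Order.TTheory GRing.Theory Num.Theory numFieldNormedType.Exports.
Local Open Scope classical_set_scope.
Local Open Scope ring_scope.
Local Open Scope complex_scope.

(** * Higher-rank graphs *)

(* A k-graph whose set of objects is V; the elements of N^k are finite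
   functions 'I_k -> nat.  As in the literature, paths compose right to left:
   [pcomp l m] is the product l m, and is meaningful only when src l = rng m
   (it is an arbitrary path otherwise).  By unique factorisation the paths of
   degree 0 are exactly the identities [vtx v]. *)
Record kgraph (k : nat) (V : countType) := KGraph {
  kpath :> countType;
  src : kpath -> V;
  rng : kpath -> V;
  vtx : V -> kpath;
  pcomp : kpath -> kpath -> kpath;
  deg : kpath -> {ffun 'I_k -> nat};
  src_vtx : forall v, src (vtx v) = v;
  rng_vtx : forall v, rng (vtx v) = v;
  src_pcomp : forall l m, src l = rng m -> src (pcomp l m) = src m;
  rng_pcomp : forall l m, src l = rng m -> rng (pcomp l m) = rng l;
  pcomp_vtxl : forall l, pcomp (vtx (rng l)) l = l;
  pcomp_vtxr : forall l, pcomp l (vtx (src l)) = l;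
  pcompA : forall l m n, src l = rng m -> src m = rng n ->
    pcomp l (pcomp m n) = pcomp (pcomp l m) n;
  deg_vtx : forall v, deg (vtx v) = 0;
  deg_pcomp : forall l m, src l = rng m -> deg (pcomp l m) = deg l + deg m;
  factorisation : forall l m n, deg l = m + n ->
    exists! p : kpath * kpath,
      [/\ src p.1 = rng p.2, deg p.1 = m, deg p.2 = n & l = pcomp p.1 p.2]
}.

Definition basis_deg (k : nat) (i : 'I_k) : {ffun 'I_k -> nat} :=
  [ffun j => (j == i) : nat].

Definition join_deg (k : nat) (m n : {ffun 'I_k -> nat}) :
    {ffun 'I_k -> nat} :=
  [ffun j => maxn (m j) (n j)].

Section KGraphDefs.
Context (k : nat) (V : countType) (L : kgraph k V).
Implicit Types (v w : V) (l m : L) (n : {ffun 'I_k -> nat}).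

Definition finite_kgraph := forall n, finite_set [set l : L | deg l = n].

Definition no_sources := forall v n, exists l : L, rng l = v /\ deg l = n.

Definition no_sinks := forall v n, exists l : L, src l = v /\ deg l = n.

(* [#|` fset_set _ |] is the cardinality when the set is finite, which is
   always the case in a finite k-graph. *)
Definition vertex_matrix (i : 'I_k) v w : nat :=
  #|` fset_set [set l : L | [/\ rng l = v, deg l = basis_deg i
                                 & src l = w]]|.

Definition connects v w := exists l : L, rng l = v /\ src l = w.

Definition min_ext l m : set (L * L) :=
  [set p | [/\ src l = rng p.1, src m = rng p.2, pcomp l p.1 = pcomp m p.2
             & deg (pcomp l p.1) = join_deg (deg l) (deg m)]].

End KGraphDefs.

(** * Components of a k-graph with finitely many vertices *)

Section Matrices.
Context (R : realType).

Definition spectral_radius (n : nat) (M : 'M[R]_n) : R :=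
  sup [set Normc.normc z
      | z in [set z : R[i] | eigenvalue (map_mx (real_complex R) M) z]].

Definition irreducible_mx (n : nat) (M : 'M[R]_n) :=
  forall i j : 'I_n, exists m : nat, (M ^+ m) i j <> 0.

End Matrices.

Section Components.
Context (R : realType) (k : nat) (V : finType) (L : kgraph k V).
Implicit Types (C : {set V}) (i j : 'I_k) (r : 'I_k -> R).

(* Rows and columns are indexed by the enumeration of C. *)
Definition vertex_block C i : 'M[R]_#|C| :=
  \matrix_(p, q) (vertex_matrix L i (enum_val p) (enum_val q))%:R.

(* The spectral radii of the whole vertex matrix A_i and of its C x C block. *)
Definition rho i : R := spectral_radius (vertex_block [set: V]%SET i).
Definition rho_block C i : R := spectral_radius (vertex_block C i).

Definition strong_component C :=
  exists v, forall w, w \in C <-> connects L v w /\ connects L w v.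

Definition trivial_component C :=
  exists v, C = [set v]%SET /\
    forall l : L, rng l = v -> src l = v -> l = vtx L v.

Definition nontrivial_component C :=
  strong_component C /\ ~ trivial_component C.

(* Since [ln 0 = 0] here, the second equation fails when rho_block C j = 0 and
   r j > 0, exactly as it does with the convention ln 0 = -oo. *)
Definition critical r j C :=
  [/\ r j = ln (rho j), r j = ln (rho_block C j)
    & irreducible_mx (vertex_block C j)].

Definition Sigma j C : {set V} :=
  [set w | `[< exists l : L, [/\ rng l \in C,
                 exists n : nat, deg l = basis_deg j *+ n & src l = w] >]]%SET.

End Components.

(** * C*-algebras *)

(* Complex C*-algebras, not assumed unital.  The norm of a normed R[i]-module
   is a nonnegative real element of R[i]. *)
Record cstarAlgebra (R : realType) := CStarAlgebra {
  cstar_sort :> completeNormedModType R[i];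
  cmul : cstar_sort -> cstar_sort -> cstar_sort;
  star : cstar_sort -> cstar_sort;
  cmulA : associative cmul;
  cmulDl : left_distributive cmul +%R;
  cmulDr : right_distributive cmul +%R;
  cmulZl : forall (z : R[i]) a b, cmul (z *: a) b = z *: cmul a b;
  cmulZr : forall (z : R[i]) a b, cmul a (z *: b) = z *: cmul a b;
  starK : involutive star;
  starD : {morph star : a b / a + b};
  starZ : forall (z : R[i]) a, star (z *: a) = z^* *: star a;
  starM : forall a b, star (cmul a b) = cmul (star b) (star a);
  norm_cmul : forall a b, `|cmul a b| <= `|a| * `|b|;
  norm_cstar : forall a, `|cmul (star a) a| = `|a| ^+ 2
}.

Section CStar.
Context (R : realType).
Implicit Types (A B : cstarAlgebra R).

Definition star_hom A B (pi : A -> B) :=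
  [/\ forall (z : R[i]) a b, pi (z *: a + b) = z *: pi a + pi b,
      forall a b, pi (cmul a b) = cmul (pi a) (pi b)
    & forall a, pi (star a) = star (pi a)].

Definition generates A (S : set A) :=
  forall D : set A, closed D -> S `<=` D -> D 0 ->
    (forall (z : R[i]) a b, D a -> D b -> D (z *: a + b)) ->
    (forall a b, D a -> D b -> D (cmul a b)) ->
    (forall a, D a -> D (star a)) ->
    D = setT.

(* Positive linear functionals of norm 1.  The supremum of a set of reals that
   is not bounded above is 0, so the last clause includes boundedness. *)
Definition state A (phi : A -> R[i]) :=
  [/\ forall (z : R[i]) a b, phi (z *: a + b) = z * phi a + phi b,
      forall a, 0 <= phi (cmul (star a) a)
    & sup [set Normc.normc (phi a) | a in [set a | `|a| <= 1]] = 1].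

Definition dynamics A (alpha : R -> A -> A) :=
  [/\ forall t, star_hom (alpha t) /\ bijective (alpha t),
      forall a, alpha 0 a = a,
      forall s t a, alpha (s + t) a = alpha s (alpha t a)
    & forall a, continuous (fun t => alpha t a)].

(* F is an entire function extending t |-> alpha_t(a); such an F is unique,
   and F z is what is denoted alpha_z(a). *)
Definition entire_extension A (alpha : R -> A -> A) (a : A)
    (F : R[i]^o -> A) :=
  (forall z, derivable F z 1) /\ (forall t : R, F t%:C = alpha t a).

Definition analytic_elt A (alpha : R -> A -> A) (a : A) :=
  exists F, entire_extension alpha a F.

Definition KMS_state A (alpha : R -> A -> A) (beta : R) (phi : A -> R[i]) :=
  state phi /\
  forall a b F, entire_extension alpha a F -> analytic_elt alpha b ->
    phi (cmul a b) = phi (cmul b (F (0 +i* beta))).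

(** * Toeplitz-Cuntz-Krieger families *)

Section TCK.
Context (k : nat) (V : countType) (L : kgraph k V).

(* The sum in the last clause is over a finite set whenever L is finite
   ([\sum_(_ \in _)] ignores infinite supports). *)
Definition TCK_family A (T : L -> A) :=
  [/\ forall l, cmul (cmul (T l) (star (T l))) (T l) = T l,
      forall v, star (T (vtx L v)) = T (vtx L v) /\
                cmul (T (vtx L v)) (T (vtx L v)) = T (vtx L v),
      forall v w, v <> w -> cmul (T (vtx L v)) (T (vtx L w)) = 0,
      forall l m, src l = rng m -> cmul (T l) (T m) = T (pcomp l m)
    & forall l m, cmul (star (T l)) (T m) =
        \sum_(p \in min_ext l m) cmul (T p.1) (star (T p.2))].

(* (A, t) is the Toeplitz algebra TC*(L) with its universal family. *)
Definition universal_TCK A (t : L -> A) :=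
  [/\ TCK_family t, generates (range t)
    & forall B (T : L -> B), TCK_family T ->
        exists pi : A -> B, star_hom pi /\ forall l, pi (t l) = T l].

(* exp(i t (r . n)) *)
Definition phase (r : 'I_k -> R) (t : R) (n : {ffun 'I_k -> nat}) : R[i] :=
  let x := t * \sum_(i < k) r i * (n i)%:R in cos x +i* sin x.

(* alpha is the action alpha^r on TC*(L); it is unique since t generates A. *)
Definition gauge_dynamics A (t : L -> A) (r : 'I_k -> R)
    (alpha : R -> A -> A) :=
  dynamics alpha /\
  forall s l, alpha s (t l) = phase r s (deg l) *: t l.

End TCK.
End CStar.

(* Main.v *)
(* Let m_v = psi(q_v).  The KMS condition gives
   psi(t_l t_l^* ) = exp(- r . d(l)) m_{s(l)}, and q_v dominates the sum of the
   mutually orthogonal projections t_l t_l^* over l in v L^{e_j}, so that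
   A_j m <= exp(r_j) m.  On a j-critical component C this makes m|_C
   subinvariant for the irreducible matrix A_{C,j} with constant
   rho(A_{C,j}) = exp(r_j), hence invariant; therefore m vanishes at every
   vertex outside C that is the source of an edge of degree e_j with range
   in C.  Subinvariance then propagates the zeros of m backwards along paths
   of degree in N e_j. *)
Require Import Defs.
From HB Require Import structures.
From mathcomp Require Import all_boot all_order all_algebra finmap.
From mathcomp Require Import all_classical all_reals all_analysis complex.
From mathcomp Require Import ring lra.
Import Order.TTheory GRing.Theory Num.Theory numFieldNormedType.Exports.
Set Implicit Arguments.
Unset Strict Implicit.
Unset Printing Implicit Defensive.
Local Open Scope classical_set_scope.
Local Open Scope ring_scope.

(** * Subinvariant vectors of irreducible nonnegative matrices *)

Lemma mulmx_ge0 (R : realType) (n p q : nat) (M : 'M[R]_(n, p)) (N : 'M[R]_(p, q)) :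
  (forall i j, 0 <= M i j) -> (forall i j, 0 <= N i j) ->
  forall i j, 0 <= (M *m N) i j.
Proof.
by move=> M0 N0 i j; rewrite mxE; apply: sumr_ge0 => l _; rewrite mulr_ge0.
Qed.

Lemma expmx_ge0 (R : realType) (n : nat) (M : 'M[R]_n) :
  (forall i j, 0 <= M i j) -> forall m i j, 0 <= (M ^+ m) i j.
Proof.
move=> M0; elim=> [|m IHm] i j; first by rewrite expr0 mxE ler0n.
by rewrite exprS -mulmxE; exact: mulmx_ge0.
Qed.

(* Pairing a left eigenvector for [z] with [y] gives [|z| (|v| y) <= c (|v| y)]. *)
Lemma normc_eigenvalue_le (R : realType) (n : nat) (M : 'M[R]_n) (y : 'cV[R]_n)
    (c : R) (z : R[i]) :
  (forall i j, 0 <= M i j) -> (forall i, 0 < y i 0) ->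
  (forall i, (M *m y) i 0 <= c * y i 0) ->
  eigenvalue (map_mx (real_complex R) M) z -> Normc.normc z <= c.
Proof.
move=> M0 y0 My /eigenvalueP[v vM v0].
pose N (x : R[i]) := Normc.normc x.
have N0 x : 0 <= N x by case: x => a b; exact: sqrtr_ge0.
have [l vl] : exists l, v 0 l != 0.
  apply/existsP; rewrite -[X in is_true X]negbK negb_exists; apply: contra v0.
  move=> /forallP v0; apply/eqP/rowP => l; rewrite mxE; apply/eqP.
  by have := v0 l; rewrite negbK.
pose S := \sum_i N (v 0 i) * y i 0.
have S0 : 0 < S.
  rewrite /S (bigD1 l) //=; apply: ltr_pwDl.
    rewrite mulr_gt0 // lt_def N0 andbT; apply: contra vl => /eqP.
    by move=> /Normc.eq0_normc ->.
  by apply: sumr_ge0 => i _; rewrite mulr_ge0 // ltW.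
rewrite -(ler_pM2r S0) /S !mulr_sumr.
apply: (@le_trans _ _ (\sum_j (\sum_i N (v 0 i) * M i j) * y j 0)).
  apply: ler_sum => j _; rewrite mulrA ler_pM2r // -Normc.normcM.
  have -> : z * v 0 j = \sum_i v 0 i * (M i j)%:C%C.
    have /rowP/(_ j) := vM; rewrite !mxE => <-.
    by apply: eq_bigr => i _; rewrite mxE.
  have NM i : N (v 0 i * (M i j)%:C%C) = N (v 0 i) * M i j.
    rewrite /N Normc.normcM /=; congr (_ * _).
    by rewrite expr0n addr0 sqrtr_sqr ger0_norm.
  under [leRHS]eq_bigr do rewrite -NM.
  rewrite -/(N _); elim/big_ind2: _ => [|a a' b b' aa' bb'|//].
    by rewrite /N Normc.normc0.
  by apply: le_trans (lerD aa' bb'); exact: (le_normcD a b).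
under eq_bigr do rewrite mulr_suml.
rewrite exchange_big /=; apply: ler_sum => i _.
have := ler_wpM2l (N0 (v 0 i)) (My i); rewrite mxE mulr_sumr mulrCA => My'.
by under eq_bigr do rewrite -mulrA.
Qed.

(* If the inequality were strict at one entry [i0], then for a sum [B] of powers
   of [M] with positive column [i0] the vector [y = B x] would be positive with
   [M y < rho(M) y] everywhere, so [M y <= c y] for some [c < rho(M)], which
   bounds all eigenvalues by [c]. *)
Lemma subinvariant_eq (R : realType) (n : nat) (M : 'M[R]_n) (x : 'cV[R]_n) :
  (forall i j, 0 <= M i j) -> irreducible_mx M -> 0 < spectral_radius M ->
  (forall i, 0 <= x i 0) ->
  (forall i, (M *m x) i 0 <= spectral_radius M * x i 0) ->
  forall i, (M *m x) i 0 = spectral_radius M * x i 0.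
Proof.
set s := spectral_radius M => M0 Mirr s0 x0 Mx i0.
apply/eqP; rewrite eq_le Mx /=; case: (leP (s * x i0 0) _) => // lti0.
pose d := s *: x - M *m x.
have dE i : d i 0 = s * x i 0 - (M *m x) i 0 by rewrite !mxE.
have d0 i : 0 <= d i 0 by rewrite dE subr_ge0.
have [m mP] := choice (fun i => Mirr i i0).
pose B := \sum_i M ^+ m i.
have B0 i j : 0 <= B i j.
  by rewrite summxE; apply: sumr_ge0 => l _; exact: expmx_ge0.
have Bi0 i : 0 < B i i0.
  rewrite summxE (bigD1 i) //=; apply: ltr_pwDl.
    by rewrite lt_def expmx_ge0 // andbT; apply/eqP/mP.
  by apply: sumr_ge0 => l _; exact: expmx_ge0.
have BM : M *m B = B *m M.
  rewrite mulmxE mulr_sumr mulr_suml; apply: eq_bigr => i _.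
  by rewrite -exprS exprSr.
pose y := B *m x.
(* As [B] commutes with [M], the gap [s *: y - M *m y] equals [B *m d], whose [i]-th entry is at
   least [B i i0 * d i0 0 > 0]. *)
have My_lt i : (M *m y) i 0 < s * y i 0.
  have -> : s * y i 0 = (M *m y) i 0 + (B *m d) i 0.
    rewrite mulmxBr -scalemxAr (mulmxA B) -BM -mulmxA -/y.
    by move: (y) => y1; rewrite !mxE addrCA subrr addr0.
  rewrite ltrDl mxE (bigD1 i0) //=; apply: ltr_pwDl.
    by rewrite mulr_gt0 // dE subr_gt0.
  by apply: sumr_ge0 => l _; rewrite mulr_ge0.
(* [M *m y] is nonnegative and [0 < s], so the strict bound itself makes [y] positive. *)
have y_gt0 i : 0 < y i 0.
  rewrite -(pmulr_rgt0 _ s0); apply: le_lt_trans (My_lt i).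
  apply: mulmx_ge0 => // l j; rewrite ord1.
  by apply: mulmx_ge0 => // p q; rewrite ord1.
(* The largest of finitely many ratios below [s]; the default 0 is harmless because [0 < s]. *)
pose c := \big[Num.max/0]_i ((M *m y) i 0 / y i 0).
have c_lt : c < s.
  by apply: bigmax_lt => // i _; rewrite ltr_pdivrMr.
have My_le i : (M *m y) i 0 <= c * y i 0.
  by rewrite -ler_pdivrMr //; exact: le_bigmax.
suff : s <= c by rewrite leNgt c_lt.
rewrite /s /spectral_radius; set E := (X in sup X).
have [E0|E0] := pselect (E !=set0)%classic.
  apply: ge_sup => // _ [z /= zP <-]; exact: (normc_eigenvalue_le M0 y_gt0 My_le).
(* Without eigenvalues the supremum would take its default value 0, against [0 < s]. *)
by have := s0; rewrite /s /spectral_radius sup_out ?ltxx // => -[].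
Qed.

(** * The complex exponential *)

(** The function $e^z$, which continues the phases of the dynamics to complex time. *)
Definition cexp (R : realType) (z : R[i]) : R[i] :=
  (expR (complex.Re z))%:C%C * (cos (complex.Im z) +i* sin (complex.Im z))%C.

Lemma cexpD (R : realType) (z w : R[i]) : cexp (z + w) = cexp z * cexp w.
Proof.
rewrite /cexp; case: z w => [a b] [c d] /=.
rewrite mulrACA -rmorphM -expRD; congr (_ * _).
apply/eqP; rewrite eq_complex /= cosD sinD eqxx /=.
by rewrite [X in X == _]addrC (mulrC (sin b)).
Qed.

Lemma derive_linear_approx (R : realType) (f : R -> R) (l e : R) :
  is_derive (0 : R) (1 : R) f l -> 0 < e ->
  \forall x \near 0, `|f x - f 0 - l * x| <= e * `|x|.
Proof.
move=> fl e0; have df := @ex_derive _ _ _ _ _ _ _ fl.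
have /eqaddoP/(_ e e0) := derivable_nbhs df.
rewrite (@derive_val _ _ _ _ _ _ _ fl).
apply: filterS => x /=.
have -> : ((fun h : R => f (h%:A + 0)) - (cst (f 0) + *:%R^~ l)) x
    = f (x *: 1 + 0) - (f 0 + x *: l) by [].
by rewrite addr0 /GRing.scale /= mulr1 (mulrC x) opprD addrA.
Qed.

(** Pulls real neighbourhoods of 0 back along the real and imaginary parts, which do not increase
    the modulus. *)
Lemma near0_nonexpansive (R : realType) (P : R -> Prop) (p : R[i] -> R) :
  (forall z, `|p z|%:C%C <= `|z|) ->
  (\forall x \near 0, P x) -> (\forall z \near (0 : R[i]^o), P (p z)).
Proof.
move=> pz /nbhs_norm0P[d /= d0 dP]; apply/nbhs_norm0P; exists d%:C%C => /=.
  by rewrite ltcR.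
move=> z /= zd; apply: dP => /=; rewrite -ltcR.
exact: le_lt_trans (pz z) zd.
Qed.

Lemma norm_complex_le (R : realType) (a b e : R) :
  `|a| <= e -> `|b| <= e -> `|(a +i* b)%C| <= (e + e)%:C%C.
Proof.
move=> ae be; have -> : (a +i* b)%C = a%:C%C + 'i%C * b%:C%C.
  by rewrite [LHS]complexE.
apply: le_trans (ler_normD _ _) _; rewrite rmorphD normrM; apply: lerD.
  by rewrite normc_def /= expr0n addr0 sqrtr_sqr lecR.
rewrite !normc_def /= !expr0n addr0 add0r !expr1n sqrtr1 mul1r sqrtr_sqr.
by rewrite lecR.
Qed.

Lemma normc_Im_le (R : realType) (z : R[i]) : `|complex.Im z|%:C%C <= `|z|.
Proof.
rewrite normc_def lecR -sqrtr_sqr ler_wsqrtr // lerDr; exact: sqr_ge0.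
Qed.

(** For $h = a + ib$ the real part of the error is $(e^a - 1 - a) + e^a(\cos b - 1)$ and the
    imaginary part is $e^a(\sin b - b) + (e^a - 1)b$; both are controlled by first-order estimates
    at 0. *)
Lemma cexp_linear_approx (R : realType) (e : R) : 0 < e ->
  \forall h \near (0 : R[i]^o), `|cexp h - 1 - h| <= e%:C%C * `|h|.
Proof.
(* Each part of the error is at most $3d|h|$, so the total $6d|h|$ stays below $8d|h| \le e|h|$; the
   cap 1 ensures $e^a \le 2$. *)
move=> e0; pose d := Num.min 1 (e / 8).
have d0 : 0 < d by rewrite lt_min ltr01 divr_gt0.
have d1 : d <= 1 by rewrite ge_min lexx.
have de : d * 8 <= e by rewrite -ler_pdivlMr // ge_min lexx orbT.
have exp_near : \forall a \near (0 : R), `|expR a - 1 - a| <= d * `|a|.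
  have := derive_linear_approx (is_derive_expR 0) d0.
  by rewrite expR0; apply: filterS => a; rewrite mul1r.
have cos_near : \forall b \near (0 : R), `|cos b - 1| <= d * `|b|.
  have := derive_linear_approx (is_derive_cos 0) d0.
  by rewrite sin0 cos0 oppr0; apply: filterS => a; rewrite mul0r subr0.
have sin_near : \forall b \near (0 : R), `|sin b - b| <= d * `|b|.
  have := derive_linear_approx (is_derive_sin 0) d0.
  by rewrite sin0 cos0; apply: filterS => a; rewrite mul1r subr0.
have exp_near2 : \forall a \near (0 : R), `|expR a - 1| <= d.
  have := @continuous_expR R 0 => /cvgrPdist_le/(_ d d0).
  by rewrite expR0; apply: filterS => a; rewrite distrC.
have reP := @near0_nonexpansive R _ _ (@normc_ge_Re R).
have imP := @near0_nonexpansive R _ _ (@normc_Im_le R).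
have := imP _ sin_near.
apply: filterS3 (filterI (reP _ exp_near) (reP _ exp_near2)) (imP _ cos_near).
case=> a b /= [].
set x := expR a; set y := cos b; set z := sin b => xa x1 y1 zb.
pose n := Num.sqrt (a ^+ 2 + b ^+ 2).
have an : `|a| <= n by rewrite -sqrtr_sqr ler_wsqrtr // lerDl sqr_ge0.
have bn : `|b| <= n by rewrite -sqrtr_sqr ler_wsqrtr // lerDr sqr_ge0.
have x2 : `|x| <= 2.
  rewrite -(subrK 1 x); apply: le_trans (ler_normD _ _) _.
  by rewrite normr1 lerD // (le_trans x1).
have -> : cexp (a +i* b)%C - 1 - (a +i* b)%C
    = ((x * y - 1 - a) +i* (x * z - b))%C.
  by apply/eqP; rewrite eq_complex /= !mul0r !subr0 addr0 !eqxx.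
have dn (k : R) : `|k| <= n -> d * `|k| <= d * n by move=> kn; rewrite ler_pM2l.
apply: le_trans (@norm_complex_le _ _ _ (d * n * 3) _ _) _.
- have -> : x * y - 1 - a = (x - 1 - a) + x * (y - 1) by ring.
  apply: le_trans (ler_normD _ _) _.
  have -> : d * n * 3 = d * n + 2 * (d * n) by ring.
  apply: lerD; first exact: le_trans xa (dn _ an).
  rewrite normrM; apply: ler_pM => //; exact: le_trans y1 (dn _ bn).
- have -> : x * z - b = x * (z - b) + (x - 1) * b by ring.
  apply: le_trans (ler_normD _ _) _.
  have -> : d * n * 3 = 2 * (d * n) + d * n by ring.
  rewrite !normrM; apply: lerD; apply: ler_pM => //.
  exact: le_trans zb (dn _ bn).
rewrite [X in _ <= _ * X]normc_def -rmorphM lecR /= -/n.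
have n0 : 0 <= n by exact: sqrtr_ge0.
have : 0 <= d * n by rewrite mulr_ge0 // ltW.
have : d * 8 * n <= e * n by rewrite ler_wpM2r.
by lra.
Qed.

(** The functional equation factors $f(cz)$ out of the difference quotient at $z$, which leaves the
    limit of $h^{-1}(f(ch) - 1)$ at 0, namely $c$. *)
Lemma derivable_expmorph (K : numFieldType) (W : normedModType K) (f : K -> K)
    (a : W) (c z : K) :
  {morph f : x y / x + y >-> x * y} ->
  (forall e, 0 < e -> \forall h \near 0, `|f h - 1 - h| <= e * `|h|) ->
  derivable (fun w : K^o => f (c * w) *: a) z 1.
Proof.
move=> fD f_approx.
have key : h^-1 * (f (c * h) - 1) @[h --> 0^'] --> c.
  apply/cvgrPdist_le => e e0.
  (* A bound for $|c|$ that is positive even when $c = 0$, so that dividing by it is safe. *)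
  pose n := `|c| + 1.
  have n0 : 0 < n by rewrite ltr_wpDl.
  have /nbhs_norm0P[d /= d0 dP] := f_approx _ (divr_gt0 e0 n0).
  near=> h.
  have h0 : h != 0 by near: h; exact: nbhs_dnbhs_neq.
  have hd : `|h| < d / n by near: h; apply: dnbhs0_lt; rewrite divr_gt0.
  have nh0 : 0 < `|h| by rewrite normr_gt0.
  have cn : `|c| <= n by rewrite lerDl ler01.
  have /dP : `|c * h| < d.
    rewrite normrM; apply: le_lt_trans (ler_wpM2r (ltW nh0) cn) _.
    by rewrite mulrC -ltr_pdivlMr.
  rewrite normrM mulrA => chP.
  rewrite -(ler_pM2r nh0) -normrM mulrBl mulrAC mulVf // mul1r distrC.
  apply: le_trans chP _; apply: ler_wpM2r; first exact: ltW.
  by rewrite mulrAC ler_pdivrMr // ler_pM2l.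
rewrite /derivable.
have -> : (fun h : K => h^-1 *: (((fun w : K^o => f (c * w) *: a) \o shift z)
      (h *: 1) - f (c * z) *: a))
    = fun h => (h^-1 * (f (c * h) - 1)) *: (f (c * z) *: a).
  apply/funext => h /=; rewrite mulrDr fD -scalerBl !scalerA; congr (_ *: _).
  by rewrite -mulrA mulrBl mul1r /GRing.scale /= mulr1.
apply: cvgP (cvgZr_tmp (a := f (c * z) *: a) key).
Unshelve. all: by end_near. Qed.

Lemma derivable_cexp (R : realType) (W : normedModType R[i]) (a : W) (c z : R[i]) :
  derivable (fun w : R[i]^o => cexp (c * w) *: a) z 1.
Proof.
apply: derivable_expmorph; first exact: cexpD.
(* A positive element of [R[i]] is real, which reduces the claim to a real tolerance. *)
move=> e e0; have [e1 eE] : exists e1 : R, e = e1%:C%C.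
  by apply/complex_realP/gtr0_real.
by move: e0; rewrite eE ltcR; exact: cexp_linear_approx.
Qed.

Lemma cexp_itime (R : realType) (c t : R) :
  cexp ('i%C * c%:C%C * t%:C%C) = (cos (t * c) +i* sin (t * c))%C.
Proof.
rewrite -mulrA -rmorphM /cexp /= !(mul0r, mul1r, mulr0, subr0, add0r, oppr0, expR0).
by rewrite mulrC.
Qed.

(** At imaginary time the phase turns into a Boltzmann factor. *)
Lemma cexp_inverse_temp (R : realType) (c b : R) :
  cexp ('i%C * c%:C%C * (0 +i* b)%C) = (expR (- (c * b)))%:C%C.
Proof.
rewrite /cexp /= !(mul0r, mul1r, mulr0, sub0r, oppr0, addr0, add0r).
by rewrite cos0 sin0 mulr1.
Qed.

Lemma entire_extension_phase (R : realType) (A : cstarAlgebra R)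
    (alpha : R -> A -> A) (a : A) (c : R) :
  (forall t, alpha t a = (cos (t * c) +i* sin (t * c))%C *: a) ->
  entire_extension alpha a (fun z => cexp ('i%C * c%:C%C * z) *: a).
Proof.
by move=> alphaE; split=> [z|t]; [exact: derivable_cexp|rewrite cexp_itime alphaE].
Qed.

(** * Projections, Toeplitz-Cuntz-Krieger families and KMS states *)

Section CStarTheory.
Context (R : realType) (A : cstarAlgebra R).
Implicit Types (a b e : A).

Lemma cmul0l a : cmul 0 a = 0.
Proof. by rewrite -[X in cmul X a](scale0r (0 : A)) cmulZl scale0r. Qed.

Lemma cmul0r a : cmul a 0 = 0.
Proof. by rewrite -[X in cmul a X](scale0r (0 : A)) cmulZr scale0r. Qed.

Lemma star0 : star (0 : A) = 0.
Proof. by rewrite -[X in star X](scale0r (0 : A)) starZ conjC0 scale0r. Qed.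

Lemma cmulNl a b : cmul (- a) b = - cmul a b.
Proof. by rewrite -scaleN1r cmulZl scaleN1r. Qed.

Lemma cmulNr a b : cmul a (- b) = - cmul a b.
Proof. by rewrite -scaleN1r cmulZr scaleN1r. Qed.

Lemma starN a : star (- a) = - star a.
Proof. by rewrite -scaleN1r starZ rmorphN rmorph1 scaleN1r. Qed.

Lemma cmul_suml (I : Type) (s : seq I) (F : I -> A) a :
  cmul (\sum_(i <- s) F i) a = \sum_(i <- s) cmul (F i) a.
Proof. exact: (big_morph _ (fun x y => cmulDl x y a) (cmul0l a)). Qed.

Lemma cmul_sumr (I : Type) (s : seq I) (F : I -> A) a :
  cmul a (\sum_(i <- s) F i) = \sum_(i <- s) cmul a (F i).
Proof. exact: (big_morph _ (cmulDr a) (cmul0r a)). Qed.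

Lemma star_sum (I : Type) (s : seq I) (F : I -> A) :
  star (\sum_(i <- s) F i) = \sum_(i <- s) star (F i).
Proof. exact: (big_morph _ (@starD _ A) star0). Qed.

Definition projection e := star e = e /\ cmul e e = e.

(** The sum $P$ is a projection by orthogonality; $qP = P$ and, by adjoints, $Pq = P$, so $(q - P)^2
    = q - P - P + P$. *)
Lemma projectionB_sum (I : eqType) (s : seq I) (p : I -> A) q :
  uniq s -> projection q -> {in s, forall i, projection (p i)} ->
  {in s &, forall i j, i != j -> cmul (p i) (p j) = 0} ->
  {in s, forall i, cmul q (p i) = p i} ->
  projection (q - \sum_(i <- s) p i).
Proof.
move=> s_uniq [q1 q2] p_proj p_orth qp.
set P := \sum_(i <- s) p i.
have starP : star P = P.
  by rewrite star_sum; apply: eq_big_seq => i /p_proj[].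
have qP : cmul q P = P by rewrite cmul_sumr; exact: eq_big_seq.
have Pq : cmul P q = P by rewrite -{1}starP -q1 -starM qP starP.
have PP : cmul P P = P.
  rewrite {1}/P cmul_suml; apply: eq_big_seq => i si.
  rewrite cmul_sumr (bigD1_seq i) //= (p_proj i si).2 big_seq_cond big1 ?addr0 //.
  by move=> j /andP[sj ji]; rewrite p_orth // eq_sym.
split; first by rewrite starD starN q1 starP.
by rewrite cmulDl !cmulDr !cmulNl !cmulNr q2 qP Pq PP opprK addNr addr0.
Qed.

End CStarTheory.

Section States.
Context (R : realType) (A : cstarAlgebra R) (phi : A -> R[i]).
Hypothesis phiP : state phi.

Lemma state0 : phi 0 = 0.
Proof.
have [lin _ _] := phiP; apply: (addrI (phi 0)).
by have := lin 1 0 0; rewrite scaler0 addr0 mul1r => <-; rewrite addr0.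
Qed.

Lemma stateD a b : phi (a + b) = phi a + phi b.
Proof. by have [lin _ _] := phiP; rewrite -(scale1r a) lin mul1r scale1r. Qed.

Lemma stateZ z a : phi (z *: a) = z * phi a.
Proof. by have [lin _ _] := phiP; rewrite -(addr0 (z *: a)) lin state0 addr0. Qed.

Lemma stateB a b : phi (a - b) = phi a - phi b.
Proof. by rewrite stateD -scaleN1r stateZ mulN1r. Qed.

Lemma state_sum (I : Type) (s : seq I) (F : I -> A) :
  phi (\sum_(i <- s) F i) = \sum_(i <- s) phi (F i).
Proof. exact: (big_morph _ stateD state0). Qed.

Lemma state_projection_ge0 e : projection e -> 0 <= phi e.
Proof. by have [_ pos _] := phiP; case=> e1 e2; rewrite -e2 -{1}e1. Qed.

End States.

(* [ssrfun.pcomp] shadows the composition of paths. *)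
Local Notation pcomp := Defs.pcomp.

(** * Minimal common extensions of paths of equal degree *)

Section Paths.
Context (k : nat) (V : countType) (L : kgraph k V).
Implicit Types (l m : L).

Lemma factorisation_inj l1 m1 l2 m2 :
  src l1 = rng m1 -> src l2 = rng m2 -> deg l1 = deg l2 -> deg m1 = deg m2 ->
  pcomp l1 m1 = pcomp l2 m2 -> l1 = l2 /\ m1 = m2.
Proof.
move=> lm1 lm2 dl dm E.
have [p [_ p_uniq]] := factorisation (deg_pcomp lm1).
suff [] : (l1, m1) = (l2, m2) by [].
by rewrite -[LHS]p_uniq //; apply: p_uniq.
Qed.

(** [l] preceded by its range vertex and [l] followed by its source vertex are two factorisations
    with all degrees 0, so their first factors agree. *)
Lemma deg0_vtx l : deg l = 0 -> l = vtx L (rng l).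
Proof.
move=> l0.
apply: (proj1 (@factorisation_inj l (vtx L (src l)) (vtx L (rng l)) l _ _ _ _ _)).
- by rewrite rng_vtx.
- by rewrite src_vtx.
- by rewrite deg_vtx.
- by rewrite deg_vtx.
- by rewrite pcomp_vtxl pcomp_vtxr.
Qed.

(** The join of equal degrees is that same degree, so both extending paths have degree 0 and are
    vertices. *)
Lemma min_ext_deg_eq l m p : deg l = deg m -> min_ext l m p ->
  l = m /\ p = (vtx L (src l), vtx L (src l)).
Proof.
case: p => p1 p2 dlm [/= lp1 mp2 E].
have -> : join_deg (deg l) (deg m) = deg l.
  by apply/ffunP => i; rewrite ffunE dlm maxnn.
have addI0 (a b : {ffun 'I_k -> nat}) : a + b = a -> b = 0.
  move=> /ffunP ab; apply/ffunP => i; have := ab i; rewrite !ffunE.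
  by rewrite -[RHS]addn0 => /addnI.
move=> d1; have d2 := d1; rewrite E (deg_pcomp mp2) -dlm in d2.
rewrite (deg_pcomp lp1) in d1.
have {}d1 := addI0 _ _ d1; have {}d2 := addI0 _ _ d2.
have [lm _] := factorisation_inj lp1 mp2 dlm (etrans d1 (esym d2)) E.
by split=> //; rewrite (deg0_vtx d1) (deg0_vtx d2) -lp1 -mp2 lm.
Qed.

Lemma min_ext_refl l : min_ext l l = [set (vtx L (src l), vtx L (src l))].
Proof.
apply/seteqP; split=> [p /(min_ext_deg_eq erefl)[] //|_ ->].
split=> /=; rewrite ?rng_vtx ?pcomp_vtxr //.
by apply/ffunP => i; rewrite ffunE maxnn.
Qed.

Lemma min_ext_neq l m : deg l = deg m -> l <> m -> min_ext l m = set0.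
Proof. by move=> dlm lm; apply/seteqP; split=> // p /(min_ext_deg_eq dlm)[]. Qed.

End Paths.

(** * Range projections in a Toeplitz-Cuntz-Krieger family *)

Section TCKTheory.
Context (R : realType) (A : cstarAlgebra R) (k : nat) (V : countType)
  (L : kgraph k V) (T : L -> A).
Hypothesis TP : TCK_family T.

Lemma TCK_vtx v : projection (T (vtx L v)).
Proof. by have [_ /(_ v)] := TP. Qed.

Lemma TCK_star_mul l : cmul (star (T l)) (T l) = T (vtx L (src l)).
Proof.
have [_ _ _ _ ->] := TP; rewrite min_ext_refl fsbig_set1 /=.
by have [-> ->] := TCK_vtx (src l).
Qed.

Lemma TCK_star_mul_neq l m : deg l = deg m -> l <> m -> cmul (star (T l)) (T m) = 0.
Proof. by have [_ _ _ _ ->] := TP => dlm /min_ext_neq ->; rewrite ?fsbig_set0. Qed.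

Lemma TCK_range_proj l : projection (cmul (T l) (star (T l))).
Proof.
have [pi _ _ _ _] := TP; split; first by rewrite starM starK.
by rewrite cmulA pi.
Qed.

(** Distinct paths of equal degree have orthogonal ranges. The resulting domination by the vertex
    projection is cast as a projection so that a state is nonnegative on it. *)
Lemma TCK_gap_projection v n (s : seq L) :
  uniq s -> {in s, forall l, rng l = v /\ deg l = n} ->
  projection (T (vtx L v) - \sum_(l <- s) cmul (T l) (star (T l))).
Proof.
move=> s_uniq sP; have [_ _ _ T2 _] := TP; apply: projectionB_sum => //.
- exact: TCK_vtx.
- by move=> l _; exact: TCK_range_proj.
- move=> l m /sP[_ dl] /sP[_ dm] /eqP lm.
  rewrite cmulA -(cmulA (T l)) TCK_star_mul_neq ?cmul0r ?cmul0l //.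
  by rewrite dl dm.
- by move=> l /sP[<- _]; rewrite cmulA T2 ?src_vtx ?pcomp_vtxl.
Qed.

End TCKTheory.

(** * Vertex weights of a KMS state *)

Section KMS.
Context (R : realType) (k : nat) (V : finType) (L : kgraph k V) (r : 'I_k -> R).
Context (A : cstarAlgebra R) (t : L -> A) (alpha : R -> A -> A) (psi : A -> R[i]).
Hypotheses (Lfin : finite_kgraph L) (tP : TCK_family t).
Hypotheses (alphaP : gauge_dynamics t r alpha) (psiP : KMS_state alpha 1 psi).

(** The KMS condition for [t l] and [star (t l)]: continuing [t l] to time $i$ only rescales it, and
    [star (t l)] times [t l] is the source projection. *)
Lemma KMS_range_proj l :
  psi (cmul (t l) (star (t l))) =
  (expR (- \sum_i r i * (deg l i)%:R))%:C%C * psi (t (vtx L (src l))).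
Proof.
have [st kms] := psiP; have [[hom _ _ _] phaseE] := alphaP.
set x := \sum_i r i * (deg l i)%:R.
have alphaE u : alpha u (t l) = (cos (u * x) +i* sin (u * x))%C *: t l.
  exact: phaseE.
(* The adjoint conjugates the phase, so [star (t l)] rotates with frequency [- x] and is analytic
   too. *)
have star_alphaE u : alpha u (star (t l))
    = (cos (u * - x) +i* sin (u * - x))%C *: star (t l).
  have [[_ _ ->] _] := hom u; rewrite alphaE starZ /= mulrN cosN sinN.
  by [].
have an : analytic_elt alpha (star (t l)).
  by eexists; exact: entire_extension_phase star_alphaE.
rewrite (kms _ _ _ (entire_extension_phase alphaE) an) cexp_inverse_temp mulr1.
by rewrite cmulZr (stateZ st) TCK_star_mul.
Qed.

(** Taking the real part loses nothing, since a state is nonnegative on projections. *)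
Definition vertex_weight v : R := complex.Re (psi (t (vtx L v))).

Lemma vertex_weightE v : psi (t (vtx L v)) = (vertex_weight v)%:C%C.
Proof.
rewrite RRe_real // ger0_real //.
by apply: state_projection_ge0; [exact: psiP.1|exact: TCK_vtx].
Qed.

Lemma vertex_weight_ge0 v : 0 <= vertex_weight v.
Proof.
rewrite -ler0c -vertex_weightE.
by apply: state_projection_ge0; [exact: psiP.1|exact: TCK_vtx].
Qed.

(** Groups the edges with range [v] by their source. *)
Lemma sum_vertex_matrix (f : V -> R) i v :
  \sum_w (vertex_matrix L i v w)%:R * f w =
  \sum_(l <- fset_set [set l : L | rng l = v /\ deg l = basis_deg i]) f (src l).
Proof.
have fin (P : set L) : P `<=` [set l | deg l = basis_deg i] -> finite_set P.
  by move=> PS; apply: sub_finite_set PS (Lfin _).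
rewrite [RHS](partition_big (@src _ _ L) xpredT) //=; apply: eq_bigr => w _.
under [RHS]eq_bigr => l /eqP -> do over.
rewrite -big_filter big_const_seq count_predT iter_addr addr0 mulr_natl.
congr (_ *+ _); apply: perm_size; apply: uniq_perm; rewrite ?filter_uniq ?fset_uniq //.
move=> l; rewrite mem_filter !in_fset_set; last 2 first.
- by apply: fin => l' [].
- by apply: fin => l' [].
apply/idP/andP.
  by rewrite inE => -[rl dl sl]; split; [apply/eqP|rewrite inE].
by rewrite inE => -[/eqP sl]; rewrite inE => -[rl dl].
Qed.

Lemma vertex_weight_subinvariant i v :
  \sum_w (vertex_matrix L i v w)%:R * vertex_weight w
    <= expR (r i) * vertex_weight v.
Proof.
rewrite sum_vertex_matrix; set S := fset_set _.
have SP : {in S, forall l : L, rng l = v /\ deg l = basis_deg i}.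
  move=> l; rewrite in_fset_set ?inE //.
  by apply: sub_finite_set (Lfin (basis_deg i)) => l' [].
have := state_projection_ge0 psiP.1 (TCK_gap_projection tP (fset_uniq S) SP).
rewrite (stateB psiP.1) (state_sum psiP.1) subr_ge0.
have -> : \sum_(l <- S) psi (cmul (t l) (star (t l)))
    = (expR (- r i) * \sum_(l <- S) vertex_weight (src l))%:C%C.
  rewrite rmorphM rmorph_sum mulr_sumr; apply: eq_big_seq => l /SP[_ dl].
  rewrite KMS_range_proj dl vertex_weightE (bigD1 i) //= ffunE eqxx mulr1.
  rewrite big1 ?addr0 // => j /negPf ji; by rewrite ffunE ji mulr0.
by rewrite vertex_weightE lecR expRN ler_pdivrMl ?expR_gt0.
Qed.

End KMS.

(** * Critical components *)

Lemma vertex_matrix_gt0 (k : nat) (V : countType) (L : kgraph k V) (i : 'I_k) (l : L) :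
  finite_kgraph L -> deg l = basis_deg i ->
  (0 < vertex_matrix L i (rng l) (src l))%N.
Proof.
move=> Lfin dl; rewrite cardfs_gt0; apply/fset0Pn; exists l.
rewrite in_fset_set ?inE //.
by apply: sub_finite_set (Lfin (basis_deg i)) => l' [].
Qed.

(** Induction on [n]: factorisation peels off the edge at the range end, and a path of degree 0 is a
    vertex. *)
Lemma edge_closed_path (k : nat) (V : countType) (L : kgraph k V) (i : 'I_k)
    (G : V -> Prop) :
  (forall l : L, deg l = basis_deg i -> G (rng l) -> G (src l)) ->
  forall n (l : L), deg l = basis_deg i *+ n -> G (rng l) -> G (src l).
Proof.
move=> G_edge; elim=> [|n IHn] l; first by move=> /deg0_vtx ->; rewrite src_vtx rng_vtx.
rewrite mulrS => /factorisation[[p1 p2] [[/= p12 d1 d2 ->] _]].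
rewrite rng_pcomp // src_pcomp // => /(G_edge _ d1); rewrite p12; exact: IHn.
Qed.

(** By [subinvariant_eq] the terms inside [C] already exhaust [expR (r j) * m v]; the nonnegative
    terms outside must vanish, and that of [u] has a positive coefficient. *)
Lemma critical_weight_eq0 (R : realType) (k : nat) (V : finType) (L : kgraph k V)
    (r : 'I_k -> R) (j : 'I_k) (C : {set V}) (m : V -> R) (v u : V) :
  0 < r j -> critical L r j C -> (forall w, 0 <= m w) ->
  (forall w, \sum_w' (vertex_matrix L j w w')%:R * m w' <= expR (r j) * m w) ->
  v \in C -> u \notin C -> (0 < vertex_matrix L j v u)%N -> m u = 0.
Proof.
move=> rj0 [_ rC irr] m0 m_sub vC uC vu.
(* [ln] is 0 on nonpositive arguments, so [0 < r j] rules them out. *)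
have s0 : 0 < rho_block R L C j.
  rewrite ltNge; apply/negP => /ln0 sC0.
  by move: rj0; rewrite rC sC0 ltxx.
have rE : expR (r j) = rho_block R L C j by rewrite rC lnK.
pose x : 'cV[R]_#|C| := \col_p m (enum_val p).
have MxE p : (vertex_block R L C j *m x) p 0
    = \sum_(w in C) (vertex_matrix L j (enum_val p) w)%:R * m w.
  by rewrite mxE [RHS]big_enum_val; apply: eq_bigr => q _; rewrite !mxE.
have split_sum w : \sum_w' (vertex_matrix L j w w')%:R * m w'
    = \sum_(w' in C) (vertex_matrix L j w w')%:R * m w'
      + \sum_(w' | w' \notin C) (vertex_matrix L j w w')%:R * m w'.
  exact: bigID.
have out0 w w' : 0 <= (vertex_matrix L j w w')%:R * m w' by rewrite mulr_ge0.
have eqC : \sum_(w in C) (vertex_matrix L j v w)%:R * m w = expR (r j) * m v.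
  have := @subinvariant_eq R _ (vertex_block R L C j) x.
  move=> /(_ _ irr s0 _ _ (enum_rank_in vC v)).
  rewrite MxE mxE enum_rankK_in // rE; apply.
  - by move=> p q; rewrite mxE.
  - by move=> p; rewrite mxE.
  - move=> p; rewrite MxE mxE -[spectral_radius _]rE.
    apply: le_trans (m_sub _); rewrite split_sum lerDl; exact: sumr_ge0.
have := m_sub v; rewrite split_sum eqC gerDl => le0.
have /eqP : \sum_(w' | w' \notin C) (vertex_matrix L j v w')%:R * m w' = 0.
  by apply/eqP; rewrite eq_le le0 sumr_ge0.
rewrite psumr_eq0 // => /allP/(_ u (mem_index_enum u)); rewrite uC /=.
by rewrite mulf_eq0 pnatr_eq0 -leqn0 leqNgt vu /= => /eqP.
Qed.

Theorem proposition3p1 (R : realType) (k : nat) (V : finType)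
  (L : kgraph k V) (r : 'I_k -> R) (j : 'I_k) (C : {set V})
  (Lfin : finite_kgraph L) (Lsrc : no_sources L) (Lsnk : no_sinks L)
  (r_gt0 : forall i, 0 < r i)
  (r_max : (forall i, (r i)^-1 * ln (rho R L i) <= 1) /\
           (exists i, (r i)^-1 * ln (rho R L i) = 1))
  (C_comp : nontrivial_component L C) (C_crit : critical L r j C)
  (A : cstarAlgebra R) (t : L -> A) (At : universal_TCK t)
  (alpha : R -> A -> A) (alphaP : gauge_dynamics t r alpha)
  (psi : A -> R[i]) (psiP : KMS_state alpha 1 psi) :
  forall w : V, w \in (Sigma L j C :\: C)%SET -> psi (t (vtx L w)) = 0.
Proof.
have [tP _ _] := At.
pose m := vertex_weight t psi.
have m0 : forall v, 0 <= m v := vertex_weight_ge0 tP psiP.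
have m_sub v : \sum_w (vertex_matrix L j v w)%:R * m w <= expR (r j) * m v.
  exact: (vertex_weight_subinvariant Lfin tP alphaP psiP).
move=> w; rewrite !inE => /andP[wC /asboolP[l [lC [n dl] lw]]].
(* This disjunction passes along every edge of degree $e_j$: an edge leaving [C] ends at weight 0,
   and weight 0 is inherited by sources. *)
suff : w \in C \/ m w = 0.
  by case=> [|mw]; [rewrite (negPf wC)|rewrite (vertex_weightE tP psiP) -/m mw].
rewrite -lw; apply: (edge_closed_path (G := fun v => v \in C \/ m v = 0)) dl _; last by left.
move=> {wC lC lw}l dl; have A0 := vertex_matrix_gt0 Lfin dl; case=> [lC|ml0].
  have [|sC] := boolP (src l \in C); first by left.
  by right; exact: (critical_weight_eq0 (r_gt0 j) C_crit m0 m_sub lC sC A0).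
right; apply/eqP; rewrite eq_le m0 andbT.
(* The nonnegative sum is now bounded by 0, so its term at [src l], which has a positive
   coefficient, is 0. *)
have := m_sub (rng l); rewrite ml0 mulr0 (bigD1 (src l)) //= => le0.
rewrite -(@pmulr_rle0 _ (vertex_matrix L j (rng l) (src l))%:R) ?ltr0n //.
apply: le_trans le0; rewrite lerDl; apply: sumr_ge0 => u _; exact: mulr_ge0.
Qed.
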